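(* Let $K$ be an infinite field of characteristic different from $2$ and $3$, and let $A=Ke\oplus U\oplus V$ be a finitely generated Bernstein algebra over $K$ with $\dim V=1$. If $A$ is algebraic, then $A$ is finite-dimensional.
   Context: Algebras are not assumed associative, unital or finite-dimensional. A Bernstein algebra over $K$ is a commutative $K$-algebra $A$ with a nonzero algebra homomorphism $\omega:A\to K$ satisfying $(x^2)^2=\omega(x)^2x^2$ for all $x$. Here $e$ is a nonzero idempotent of $A$ (necessarily $\omega(e)=1$) and $A=Ke\oplus U\oplus V$ is the Peirce decomposition: $U=\{u\in A:2eu=u\}$, $V=\{v\in A:ev=0\}$. $A$ is algebraic if every element generates a finite-dimensional subalgebra; finitely generated means generated as an algebra by a finite subset. *)

(* Defs.v *)
From mathcomp Require Import all_boot all_order all_algebra.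
From mathcomp Require Import boolp classical_sets functions cardinality.

Set Implicit Arguments.
Unset Strict Implicit.
Unset Printing Implicit Defensive.

Import GRing.Theory.

Local Open Scope classical_set_scope.
Local Open Scope ring_scope.

(* The library's algebras are associative and unital, so a nonassociative
   K-algebra is a K-module A, of arbitrary dimension, with a bilinear product
   mul.  Subspaces of A are sets: {vspace A} would force A to have finite
   dimension. *)

Definition has_dim (K : fieldType) (A : lmodType K) (W : set A) (n : nat) :
    Prop :=
  exists b : 'I_n -> A,
    (forall c : 'I_n -> K, \sum_(i < n) c i *: b i = 0 -> forall i, c i = 0) /\
    W = [set x | exists c : 'I_n -> K, x = \sum_(i < n) c i *: b i].

Definition finite_dim (K : fieldType) (A : lmodType K) (W : set A) : Prop :=
  exists n, has_dim W n.

Definition is_subalgebra (K : fieldType) (A : lmodType K) (mul : A -> A -> A)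
    (S : set A) : Prop :=
  [/\ S 0,
      forall (a : K) x y, S x -> S y -> S (a *: x + y) &
      forall x y, S x -> S y -> S (mul x y)].

Definition generated_subalgebra (K : fieldType) (A : lmodType K)
    (mul : A -> A -> A) (G : set A) : set A :=
  smallest (is_subalgebra mul) G.

Definition finitely_generated (K : fieldType) (A : lmodType K)
    (mul : A -> A -> A) : Prop :=
  exists G : set A, finite_set G /\ generated_subalgebra mul G = [set: A].

Definition algebraic_algebra (K : fieldType) (A : lmodType K)
    (mul : A -> A -> A) : Prop :=
  forall x : A, finite_dim (generated_subalgebra mul [set x]).

Record is_bernstein (K : fieldType) (A : lmodType K)
    (mul : {bilinear A -> A -> A}) (omega : {scalar A}) : Prop := IsBernstein {
  bernstein_mulC : forall x y, mul x y = mul y x;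
  bernstein_omega_neq0 : exists x, omega x != 0;
  bernstein_omegaM : forall x y, omega (mul x y) = omega x * omega y;
  bernsteinE : forall x,
    mul (mul x x) (mul x x) = omega x ^+ 2 *: mul x x
}.

Definition peirce_V (K : fieldType) (A : lmodType K) (mul : A -> A -> A)
  (e : A) : set A := [set v | mul e v = 0].

(* Main.v *)
(* Write V = Kw and T = (u |-> uw) on U.  Substituting e + tn with n in
   ker omega into the Bernstein identity and comparing coefficients of t gives
   the Peirce multiplication rules and u^3 = 0 on U.  As U^2 lies in Kw, either
   T = 0 or U^2 = 0.  In both cases every u in U lies in a finite-dimensional
   T-invariant subspace of U containing w^2: when U^2 = 0, take the projections
   to U of the subalgebras generated by u + w and by w.  Adding up such
   subspaces for the U-components of the generators of A, and adjoining e and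
   w, yields a finite-dimensional subalgebra containing the generators. *)
Require Import Defs.
From mathcomp Require Import all_boot all_order all_algebra.
From mathcomp Require Import boolp classical_sets functions cardinality.

Set Implicit Arguments.
Unset Strict Implicit.
Unset Printing Implicit Defensive.

Import GRing.Theory.

Local Open Scope classical_set_scope.
Local Open Scope ring_scope.

(** * Finite spans in a module of arbitrary dimension *)

Section Span.
Variables (K : fieldType) (A : lmodType K).
Implicit Types (s t : seq A) (W : set A).

Definition is_subspace W : Prop :=
  W 0 /\ forall (a : K) x y, W x -> W y -> W (a *: x + y).

Lemma subspaceD W x y : is_subspace W -> W x -> W y -> W (x + y).
Proof. by case=> _ WD Wx Wy; rewrite -[x]scale1r; apply: WD. Qed.

Lemma subspaceZ W {a : K} x : is_subspace W -> W x -> W (a *: x).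
Proof. by case=> W0 WD Wx; rewrite -[_ *: _]addr0; apply: WD. Qed.

Lemma subspaceB W x y : is_subspace W -> W x -> W y -> W (x - y).
Proof.
by case=> _ WD Wx Wy; rewrite addrC -scaleN1r; apply: WD.
Qed.

Lemma subspace_sum W I (r : seq I) (F : I -> A) :
  is_subspace W -> (forall i, W (F i)) -> W (\sum_(i <- r) F i).
Proof.
move=> subW WF; elim/big_ind: _ => [|x y|//]; first by case: subW.
exact: subspaceD.
Qed.

(** Coefficients are functions on [nat], so that one type serves sequences of every length; values
    from [size s] on are irrelevant. *)
Definition span s : set A :=
  [set x | exists c : nat -> K, x = \sum_(i < size s) c i *: s`_i].

Lemma span_subspace s : is_subspace (span s).
Proof.
split; first by exists (fun=> 0); rewrite big1 // => i _; rewrite scale0r.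
move=> a _ _ [c ->] [d ->]; exists (fun i => a * c i + d i).
rewrite scaler_sumr -big_split; apply: eq_bigr => i _.
by rewrite scalerDl scalerA.
Qed.

Lemma mem_span s x : x \in s -> span s x.
Proof.
move=> xs; exists (fun i => (i == index x s)%:R).
have xi : (index x s < size s)%N by rewrite index_mem.
rewrite (bigD1 (Ordinal xi)) //= eqxx scale1r nth_index // big1 ?addr0 // => i.
by rewrite -val_eqE /= => /negPf ->; rewrite scale0r.
Qed.

Lemma span_sub s W :
  is_subspace W -> (forall x, x \in s -> W x) -> span s `<=` W.
Proof.
move=> subW sW _ [c ->]; apply: subspace_sum => // i.
by apply: subspaceZ => //; apply/sW/mem_nth.
Qed.

Lemma span_mono s t : {subset s <= t} -> span s `<=` span t.
Proof.
by move=> st; apply: span_sub (span_subspace t) _ => x /st /mem_span.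
Qed.

Lemma span_cons_mem a s : span s a -> span (a :: s) = span s.
Proof.
move=> sa; apply/seteqP; split.
  apply: span_sub (span_subspace s) _ => x; rewrite inE.
  by case/predU1P => [->|/mem_span].
by apply: span_mono => x xs; rewrite inE xs orbT.
Qed.

Definition lin_free s : Prop := forall c : nat -> K,
  \sum_(i < size s) c i *: s`_i = 0 -> forall i, (i < size s)%N -> c i = 0.

Lemma lin_free_cons a s : lin_free s -> ~ span s a -> lin_free (a :: s).
Proof.
move=> frs nsa c; rewrite /= big_ord_recl /bump /=.
have [c0|c0] := eqVneq (c 0%N) 0.
  rewrite c0 scale0r add0r => /(frs (fun i => c i.+1)) cS [|i] //=.
  by rewrite ltnS => /cS.
move/eqP; rewrite addr_eq0 => /eqP ca; case: nsa.
rewrite -[a]scale1r -(mulVf c0) -scalerA ca -sumrN.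
exists (fun i => - (c 0%N)^-1 * c i.+1); rewrite scaler_sumr.
by apply: eq_bigr => i _; rewrite scalerN scalerA mulNr scaleNr.
Qed.

(** Going through [s] from its end, a vector is kept only if it lies outside the span of those after
    it. *)
Lemma span_basis s : exists2 t, lin_free t & span t = span s.
Proof.
elim: s => [|a s [t frt ts]]; first by exists [::].
have [sa|nsa] := pselect (span s a).
  by exists t => //; rewrite span_cons_mem.
exists (a :: t); first by apply: lin_free_cons => //; rewrite ts.
have at_sub u v : span u = span v -> span (a :: u) `<=` span (a :: v).
  move=> uv; apply: span_sub (span_subspace _) _ => x; rewrite inE.
  case/predU1P => [->|xu]; first by apply: mem_span; rewrite mem_head.
  have: span v x by rewrite -uv; apply: mem_span.
  by apply: span_mono => y yv; rewrite inE yv orbT.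
by apply/seteqP; split; apply: at_sub.
Qed.

Lemma finite_dim_span s : finite_dim (span s).
Proof.
have [t frt <-] := span_basis s.
(* [ext] extends coefficients by 0 beyond [size t], passing from ordinals to [nat]. *)
pose ext (c : 'I_(size t) -> K) k := if insub k is Some i then c i else 0.
have extE c (i : 'I_(size t)) : ext c i = c i by rewrite /ext valK.
exists (size t), (fun i : 'I_(size t) => t`_i); split=> [c c0 i|].
  rewrite -extE; apply: frt => //.
  by rewrite -[RHS]c0; apply: eq_bigr => j _; rewrite extE.
apply/seteqP; split=> x [c ->]; first by exists (fun i => c i).
by exists (ext c); apply: eq_bigr => i _; rewrite extE.
Qed.

Lemma finite_dim_spanned W : finite_dim W -> exists s, W = span s.
Proof.
case=> n [b [_ ->]]; exists (codom b); apply/seteqP; split=> [_ [c ->]|].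
  apply: subspace_sum (span_subspace _) _ => i.
  by apply: subspaceZ (span_subspace _) _; apply/mem_span/codom_f.
apply: span_sub => [|_ /codomP[i ->]].
  split; first by exists (fun=> 0); rewrite big1 // => i _; rewrite scale0r.
  move=> a _ _ [c ->] [d ->]; exists (fun i => a * c i + d i).
  rewrite scaler_sumr -big_split; apply: eq_bigr => i _.
  by rewrite scalerDl scalerA.
exists (fun j => (j == i)%:R).
rewrite (bigD1 i) //= eqxx scale1r big1 ?addr0 // => j /negPf ->.
by rewrite scale0r.
Qed.

End Span.

(** * Comparison of coefficients over an infinite field *)

Lemma vanishing_coefs (K : fieldType) (A : lmodType K) n (c : 'I_n -> A) :
  infinite_set [set: K] ->
  (forall t : K, \sum_(i < n) t ^+ i *: c i = 0) -> forall i, c i = 0.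
Proof.
move=> /(infinite_set_fset n)[B _ nB] c0 i.
(* The nodes: n distinct scalars, which make the Vandermonde determinant nonzero. *)
pose f (j : 'I_n) : K := (finmap.enum_fset B)`_j.
pose V : 'M[K]_n := Vandermonde n (\row_(j < n) f j).
have finj : injective f.
  move=> j k /eqP; rewrite nth_uniq ?finmap.fset_uniq //.
  - by move=> /eqP /val_inj.
  - exact: leq_trans (ltn_ord j) nB.
  - exact: leq_trans (ltn_ord k) nB.
have V_unit : V \in unitmx.
  rewrite unitmxE unitfE det_Vandermonde; apply/prodf_neq0 => j _.
  apply/prodf_neq0 => k jk; rewrite !mxE subr_eq0.
  by apply: contraTneq jk => /finj ->; rewrite ltnn.
(* The inverse of the Vandermonde matrix recovers the coefficients from the
   values at n distinct points. *)
have -> : c i = \sum_k invmx V k i *: \sum_(j < n) f k ^+ j *: c j.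
  under eq_bigr do rewrite scaler_sumr.
  rewrite exchange_big /= (bigD1 i) //= [X in _ + X]big1 => [|j ji].
    under eq_bigr => k _ do rewrite scalerA mulrC.
    rewrite -scaler_suml addr0.
    have := congr1 (fun M : 'M_n => M i i) (mulmxV V_unit).
    rewrite !mxE eqxx /= => E; rewrite -[LHS]scale1r -[1]E; congr (_ *: _).
    by apply: eq_bigr => k _; rewrite !mxE.
  under eq_bigr => k _ do rewrite scalerA mulrC.
  rewrite -scaler_suml.
  have := congr1 (fun M : 'M_n => M j i) (mulmxV V_unit).
  rewrite !mxE (negPf ji) /= => E; rewrite -[RHS](scale0r (c j)) -[0 in RHS]E.
  by congr (_ *: _); apply: eq_bigr => k _; rewrite !mxE.
by rewrite big1 // => k _; rewrite c0 scaler0.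
Qed.

(** * Peirce decomposition of a Bernstein algebra *)

Section Bernstein.
Variables (K : fieldType) (A : lmodType K).
Variables (mul : {bilinear A -> A -> A}) (omega : {scalar A}) (e : A).
Hypotheses (K_infinite : infinite_set [set: K]).
Hypotheses (K_char2 : 2%N \notin [pchar K]).
Hypotheses (A_bernstein : is_bernstein mul omega).
Hypotheses (e_neq0 : e != 0) (e_idem : mul e e = e).

Local Notation "x ** y" := (mul x y) (at level 40, left associativity).

Let mulC x y : x ** y = y ** x.
Proof. exact: bernstein_mulC A_bernstein x y. Qed.

Let two_neq0 : 2%:R != 0 :> K.
Proof. by move: K_char2; rewrite inE. Qed.

Let double_eq0 (x : A) : x *+ 2 = 0 -> x = 0.
Proof.
rewrite -scaler_nat => /eqP; rewrite scaler_eq0 (negPf two_neq0) /=.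
by move/eqP.
Qed.

Let double_inj (x y : A) : x *+ 2 = y *+ 2 -> x = y.
Proof.
by move=> xy; apply/subr0_eq/double_eq0; rewrite mulrnBl xy subrr.
Qed.

(** [omega e] is an idempotent of K, and the value 0 would give e = (e^2)^2 = 0. *)
Lemma omega_idem : omega e = 1.
Proof.
have E : omega e * omega e = omega e.
  by rewrite -(bernstein_omegaM A_bernstein) e_idem.
have [e0|en0] := eqVneq (omega e) 0; last first.
  by apply: (mulfI en0); rewrite E mulr1.
move: (bernsteinE A_bernstein e); rewrite !e_idem e0 expr0n scale0r => /eqP.
by rewrite (negPf e_neq0).
Qed.

Lemma sqr_quadratic x y z (t : K) :
  (x + t *: y + t ^+ 2 *: z) ** (x + t *: y + t ^+ 2 *: z) =
  x ** x + t *: ((x ** y) *+ 2) + t ^+ 2 *: (y ** y + (x ** z) *+ 2) +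
  t ^+ 3 *: ((y ** z) *+ 2) + t ^+ 4 *: (z ** z).
Proof.
rewrite !linearDl !linearDr /= !(linearZl_LR, linearZr_LR) /=.
rewrite (mulC y x) (mulC z x) (mulC z y) !scalerA.
rewrite -!exprS -!exprSr -!exprD -expr2 !mulr2n !scalerDr !addrA /=.
by rewrite [LHS](ACl (1*2*4*5*3*7*6*8*9)).
Qed.

(** With b = n^2, the square of e + tn is e + ta + t^2 b, which must equal its own square. The three
    identities are the coefficients of t, t^2 and t^3, the last one halved. *)
Lemma peirce_identities n (a := (e ** n) *+ 2) : omega n = 0 ->
  [/\ (e ** a) *+ 2 = a, a ** a + (e ** (n ** n)) *+ 2 = n ** n &
      a ** (n ** n) = 0].
Proof.
move=> n0; set b := n ** n.
pose c (i : 'I_5) :=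
  [:: 0; (e ** a) *+ 2 - a; a ** a + (e ** b) *+ 2 - b;
      (a ** b) *+ 2; b ** b]`_i.
have c0 : forall i, c i = 0.
  apply: vanishing_coefs K_infinite _ => t.
  have x2 : (e + t *: n) ** (e + t *: n) = e + t *: a + t ^+ 2 *: b.
    have := sqr_quadratic e n 0 t.
    by rewrite !linear0r mul0rn addr0 !scaler0 !addr0 e_idem.
  have := bernsteinE A_bernstein (e + t *: n).
  have -> : omega (e + t *: n) = 1.
    by rewrite linearD linearZ /= omega_idem n0 mulr0 addr0.
  rewrite x2 sqr_quadratic e_idem expr1n scale1r.
  move/eqP; rewrite -subr_eq0 => /eqP E.
  rewrite !big_ord_recl big_ord0 /c /= !scalerBr scaler0 add0r addr0 -[RHS]E.
  rewrite /bump expr1 !opprD !addrA [RHS](ACl (1*6*2*7*3*8*4*5)) /=.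
  by rewrite subrr add0r.
split.
- by have := c0 (Ordinal (isT : (1 < 5)%N)) => /subr0_eq.
- by have := c0 (Ordinal (isT : (2 < 5)%N)) => /subr0_eq.
- by have := c0 (Ordinal (isT : (3 < 5)%N)) => /double_eq0.
Qed.

Definition peirce_U (u : A) : Prop := (e ** u) *+ 2 = u.

Lemma peirce_U_subspace : is_subspace peirce_U.
Proof.
split=> [|c x y Ux Uy]; first by rewrite /peirce_U linear0r mul0rn.
by rewrite /peirce_U linearDr /= linearZr_LR /= mulrnDl scalerMnr Ux Uy.
Qed.

Lemma omega_peirce_U u : peirce_U u -> omega u = 0.
Proof.
move=> Uu; have := congr1 omega Uu.
rewrite raddfMn /= (bernstein_omegaM A_bernstein) omega_idem mul1r mulr2n.
by move/(canRL (addrK _)); rewrite subrr.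
Qed.

(** For n = u in U one has a = u, so the second Peirce identity reads u^2 + 2eu^2 = u^2;
    polarization gives the general product. *)
Lemma peirce_UM u v : peirce_U u -> peirce_U v -> e ** (u ** v) = 0.
Proof.
have sqr0 x : peirce_U x -> e ** (x ** x) = 0.
  move=> Ux; have [_ + _] := peirce_identities (omega_peirce_U Ux).
  by rewrite Ux => /(canRL (addKr _)); rewrite addNr => /double_eq0.
move=> Uu Uv; apply: double_eq0.
have := sqr0 _ (subspaceD peirce_U_subspace Uu Uv).
rewrite !(linearDl, linearDr) /= (mulC v u) !sqr0 // add0r addr0.
by rewrite mulr2n.
Qed.

Lemma peirce_U_cube0 u : peirce_U u -> u ** (u ** u) = 0.
Proof.
by move=> Uu; have [_ _] := peirce_identities (omega_peirce_U Uu); rewrite Uu.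
Qed.

(* Linearization of u^3 = 0. *)
Lemma peirce_U_cube_lin u v : peirce_U u -> peirce_U v ->
  (u ** u) ** v + ((u ** v) ** u) *+ 2 = 0.
Proof.
move=> Uu Uv; apply: double_eq0.
(* Adding the cubes of v + u and v - u cancels the terms odd in u; as v^3 = 0, twice the claim
   remains. *)
have Up := peirce_U_cube0 (subspaceD peirce_U_subspace Uv Uu).
have Um := peirce_U_cube0 (subspaceB peirce_U_subspace Uv Uu).
have := congr2 (fun x y => x + y) Up Um.
rewrite !(linearDl, linearDr, linearNl, linearNr) /= !opprK.
rewrite !peirce_U_cube0 // (mulC v u) (mulC v (u ** u)) (mulC u (u ** v)).
rewrite !(add0r, addr0, sub0r, subr0) !addrA => E.
by rewrite -[RHS]E !mulr2n !addrA [RHS](ACl (1*7*2*8*4*10*3*5*6*9*11*12)) /=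
  !(subrr, add0r).
Qed.

Lemma omega_peirce_V v : e ** v = 0 -> omega v = 0.
Proof.
move=> /(congr1 omega); rewrite (bernstein_omegaM A_bernstein) omega_idem.
by rewrite mul1r linear0.
Qed.

Lemma peirce_VM v : e ** v = 0 -> peirce_U (v ** v).
Proof.
move=> Vv; have [_ + _] := peirce_identities (omega_peirce_V Vv).
by rewrite Vv mul0rn linear0l add0r.
Qed.

(** For n = u + v again a = u. In the second Peirce identity the contributions of u^2 and v^2
    cancel, which leaves the condition on 2uv. *)
Lemma peirce_UVM u v : peirce_U u -> e ** v = 0 -> peirce_U (u ** v).
Proof.
move=> Uu Vv; have n0 : omega (u + v) = 0.
  by rewrite linearD /= omega_peirce_U // omega_peirce_V // addr0.
have [_ + _] := peirce_identities n0.
have -> : (e ** (u + v)) *+ 2 = u by rewrite linearDr /= Vv addr0.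
rewrite !(linearDl, linearDr) /= (mulC v u) peirce_UM // add0r.
rewrite !mulrnDl peirce_VM // !addrA => /addIr.
rewrite -!addrA => /addrI E; apply: double_inj.
by rewrite !mulr2n -E !addrA.
Qed.

(** The Peirce projection onto U: subtracting [omega x *: e] leaves the component in U + V, and
    multiplication by 2e fixes U and kills V. *)
Definition proj_U x := (e ** (x - omega x *: e)) *+ 2.

Lemma proj_U_linear c x y : proj_U (c *: x + y) = c *: proj_U x + proj_U y.
Proof.
rewrite /proj_U linearP /= scalerDl -scalerA -scalerMnr -mulrnDl.
by rewrite -linearZr_LR -linearDr /= scalerBr opprD addrACA.
Qed.

Lemma proj_U_peirce x : peirce_U (proj_U x).
Proof.
have n0 : omega (x - omega x *: e) = 0.
  by rewrite linearB linearZ /= omega_idem mulr1 subrr.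
by have [] := peirce_identities n0.
Qed.

Lemma proj_U_id u : peirce_U u -> proj_U u = u.
Proof. by move=> Uu; rewrite /proj_U omega_peirce_U // scale0r subr0. Qed.

Lemma peirce_decomp x :
  exists2 v, e ** v = 0 & x = omega x *: e + proj_U x + v.
Proof.
exists (x - omega x *: e - proj_U x); last by rewrite -addrA subrKC subrKC.
rewrite linearBr /=; apply: double_eq0.
by rewrite mulrnBl proj_U_peirce subrr.
Qed.

Lemma proj_U_V v : e ** v = 0 -> proj_U v = 0.
Proof.
by move=> Vv; rewrite /proj_U omega_peirce_V // scale0r subr0 Vv mul0rn.
Qed.

Lemma generated_subalgebra_closed G :
  is_subalgebra mul (generated_subalgebra mul G).
Proof.
split=> [M [[]] //|c x y Sx Sy M MG|x y Sx Sy M MG].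
- by case: (MG.1) => _ + _; apply; [apply: Sx|apply: Sy].
- by case: (MG.1) => _ _; apply; [apply: Sx|apply: Sy].
Qed.

Lemma span_mul s W :
  is_subspace W -> (forall x y, x \in s -> y \in s -> W (x ** y)) ->
  forall x y, span s x -> span s y -> W (x ** y).
Proof.
move=> subW sW x y sx; move: y; apply: span_sub => [|y ys].
  split=> [|c y z]; first by rewrite /= linear0r; case: subW.
  by rewrite /= linearDr linearZr_LR; apply: subW.2.
move: x sx; apply: span_sub => [|x xs]; last exact: sW.
split=> [|c x z]; first by rewrite /= linear0l; case: subW.
by rewrite /= linearDl linearZl_LR; apply: subW.2.
Qed.

(** * The case where V is spanned by w *)

Variable w : A.
Hypotheses (Vw : e ** w = 0).
Hypotheses (V_line : forall v, e ** v = 0 -> exists c, v = c *: w).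

Lemma peirce_dichotomy :
  (forall u, peirce_U u -> u ** w = 0) \/
  (forall u v, peirce_U u -> peirce_U v -> u ** v = 0).
Proof.
have [sqr0|/existsNP[u /not_implyP[Uu uu0]]] :=
  pselect (forall u, peirce_U u -> u ** u = 0).
  right=> u v Uu Uv; apply: double_eq0.
  have := sqr0 _ (subspaceD peirce_U_subspace Uu Uv).
  rewrite !(linearDl, linearDr) /= (mulC v u) !sqr0 // add0r addr0.
  by rewrite mulr2n.
(* u^2 = f w with f <> 0: u^3 = 0 forces uw = 0, and then linearizing u^3 = 0
   in the direction v leaves f wv = 0. *)
left=> v Uv; have [f uuE] := V_line (peirce_UM Uu Uu).
have f0 : f != 0 by apply/eqP => f0; apply: uu0; rewrite uuE f0 scale0r.
have uw0 : u ** w = 0.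
  have := peirce_U_cube0 Uu; rewrite uuE linearZr_LR => /eqP.
  by rewrite scaler_eq0 (negPf f0) => /eqP.
have [g uvE] := V_line (peirce_UM Uu Uv).
have := peirce_U_cube_lin Uu Uv; rewrite uuE uvE !linearZl_LR /= (mulC w u) uw0.
rewrite scaler0 mul0rn addr0 => /eqP; rewrite scaler_eq0 (negPf f0) (mulC w v).
by move/eqP.
Qed.

(** These conditions are what makes the span of e, w and [s] closed under multiplication. *)
Definition invariant_span s : Prop :=
  [/\ forall x, x \in s -> peirce_U x, span s (w ** w) &
      forall x, span s x -> span s (x ** w)].

Lemma invariant_span_gen s :
  (forall x, x \in s -> peirce_U x) -> span s (w ** w) ->
  (forall x, x \in s -> span s (x ** w)) -> invariant_span s.
Proof.
move=> sU sp sw; split=> //; apply: span_sub => //.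
split=> [|c x z]; rewrite /= ?linear0l; first by case: (span_subspace s).
by rewrite linearDl linearZl_LR; apply: (span_subspace s).2.
Qed.

Lemma invariant_span_cat s t :
  invariant_span s -> invariant_span t -> invariant_span (s ++ t).
Proof.
case=> sU sp sw [tU tp tw].
have s_st : span s `<=` span (s ++ t).
  by apply: span_mono => x xs; rewrite mem_cat xs.
have t_st : span t `<=` span (s ++ t).
  by apply: span_mono => x xt; rewrite mem_cat xt orbT.
apply: invariant_span_gen => [x||x]; last 2 first.
- exact: s_st.
- rewrite mem_cat => /orP[xs|xt].
    by apply/s_st/sw/mem_span.
  by apply/t_st/tw/mem_span.
by rewrite mem_cat => /orP[/sU|/tU].
Qed.

(** * Local finiteness of multiplication by w on U *)

Hypothesis A_algebraic : algebraic_algebra mul.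

Lemma locally_finite u :
  peirce_U u -> exists2 s, invariant_span s & span s u.
Proof.
move=> Uu; have Up := peirce_VM Vw.
have [T0|UU0] := peirce_dichotomy.
  (* If w annihilates U, invariance is automatic. *)
  exists [:: u; w ** w]; last by apply: mem_span; rewrite mem_head.
  have sU x : x \in [:: u; w ** w] -> peirce_U x.
    by rewrite !inE => /orP[] /eqP ->.
  apply: invariant_span_gen => // [|x /sU/T0 ->].
    by apply: mem_span; rewrite !inE eqxx orbT.
  by case: (span_subspace [:: u; w ** w]).
pose S y := generated_subalgebra mul [set y].
have memS y : S y y by apply: sub_gen_smallest.
have S_mul y x : S y x -> S y (x ** y).
  move=> Sx; case: (generated_subalgebra_closed [set y]) => _ _.
  by apply; last exact: memS.
(* The kernel of [omega] is itself a subalgebra. *)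
have S_omega y x : omega y = 0 -> S y x -> omega x = 0.
  move=> y0; apply: (@smallest_sub _ _ _ [set x | omega x = 0]) => [|_ ->] //.
  split=> /= [|c {}x z x0 z0|{}x z].
  - exact: linear0.
  - by rewrite linearP /= x0 z0 mulr0 addr0.
  - by rewrite (bernstein_omegaM A_bernstein) => -> _; rewrite mul0r.
have [su suE] := finite_dim_spanned (A_algebraic (u + w)).
have [sw swE] := finite_dim_spanned (A_algebraic w).
pose s := map proj_U (su ++ sw).
have subs := span_subspace s.
have projS t : span t `<=` [set x | span (map proj_U t) (proj_U x)].
  apply: span_sub => [|x xt]; last by apply/mem_span/map_f.
  split=> [|c x z]; rewrite /= ?proj_U_linear.
    rewrite /proj_U linear0 scale0r subr0 linear0r mul0rn.
    by case: (span_subspace (map proj_U t)).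
  exact: (span_subspace _).2.
have projSu x : S (u + w) x -> span s (proj_U x).
  rewrite /S suE => /projS; apply: span_mono => y.
  by rewrite /s map_cat mem_cat => ->.
have projSw x : S w x -> span s (proj_U x).
  rewrite /S swE => /projS; apply: span_mono => y.
  by rewrite /s map_cat mem_cat orbC => ->.
have sp : span s (w ** w).
  by rewrite -(proj_U_id Up); apply: projSw; apply: S_mul; apply: memS.
(* Write x = q + cw with q in U. As qv = 0, the product x(v + w) is qw + c(vw + w^2), already in U.
   This is used for v = u and for v = 0. *)
have proj_mul x v : omega x = 0 -> peirce_U v ->
    exists c, proj_U (x ** (v + w)) = proj_U x ** w + c *: (v ** w + w ** w).
  move=> x0 Uv; have [y Vy xE] := peirce_decomp x.
  have [c yE] := V_line Vy; exists c.
  move: (proj_U_peirce x) xE; rewrite x0 scale0r add0r yE.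
  move: (proj_U x) => q Uq ->; rewrite !(linearDl, linearDr) /=.
  rewrite (UU0 _ _ Uq Uv) add0r !linearZl_LR /= (mulC w v) -scalerDr.
  rewrite proj_U_id //.
  apply: (subspaceD peirce_U_subspace _ _).
    exact: peirce_UVM.
  apply: (subspaceZ peirce_U_subspace _).
  apply: (subspaceD peirce_U_subspace _ Up).
  exact: peirce_UVM.
(* As u^2 = 0, the square of u + w is 2uw + w^2; w^2 is subtracted and the rest halved. *)
have suw : span s (u ** w + w ** w).
  have := projSu _ (S_mul _ _ (memS (u + w))).
  rewrite !(linearDl, linearDr) /= (mulC w u) UU0 // add0r.
  rewrite proj_U_id; last first.
    have Uuw := peirce_UVM Uu Vw.
    by do 2?[apply: (subspaceD peirce_U_subspace)].
  move=> sq.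
  have two : span s ((u ** w) *+ 2).
    by have := subspaceB subs sq sp; rewrite addrA addrK mulr2n.
  apply: (subspaceD subs _ sp).
  rewrite -[u ** w]scale1r -(mulVf two_neq0) -scalerA scaler_nat.
  exact: (subspaceZ subs _).
exists s; last first.
  have := projSu _ (memS _); rewrite -[w]scale1r addrC proj_U_linear.
  by rewrite proj_U_V // scaler0 add0r proj_U_id.
apply: invariant_span_gen => // x; rewrite /s => /mapP[x0 + ->].
  by move=> _; apply: proj_U_peirce.
have U0 : peirce_U 0 by case: peirce_U_subspace.
(* Right multiplication by u + w, respectively w, preserves the subalgebra containing [x0], so
   [proj_mul] expresses [proj_U x0 ** w] as a difference of two elements of [span s]. *)
rewrite mem_cat => /orP[/mem_span|/mem_span].
  rewrite -suE => Sx.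
  have ox : omega x0 = 0.
    apply: S_omega Sx.
    by rewrite linearD /= omega_peirce_U // omega_peirce_V // addr0.
  have [c] := proj_mul _ _ ox Uu; move/esym/(canRL (addrK _)) => ->.
  apply: (subspaceB subs _ (subspaceZ subs suw)); apply: projSu.
  exact: S_mul.
rewrite -swE => Sx.
have ox : omega x0 = 0 by apply: S_omega Sx; apply: omega_peirce_V.
have [c] := proj_mul _ _ ox U0; rewrite linear0l !add0r.
move/esym/(canRL (addrK _)) => ->.
apply: (subspaceB subs _ (subspaceZ subs sp)); apply: projSw.
exact: S_mul.
Qed.

(** * From local finiteness to finite dimension *)

Lemma invariant_span_gens (g : seq A) :
  exists2 s, invariant_span s & forall x, x \in g -> span s (proj_U x).
Proof.
elim: g => [|a g [s inv_s sg]].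
  (* Even without generators the span has to contain w^2, so the family obtained for u = 0 is
     taken. *)
  by have [s inv_s _] := locally_finite peirce_U_subspace.1; exists s.
have [t inv_t ta] := locally_finite (proj_U_peirce a).
exists (t ++ s) => [|x]; first exact: invariant_span_cat.
rewrite inE => /predU1P[->|/sg].
  by apply: span_mono ta => y yt; rewrite mem_cat yt.
by apply: span_mono => y ys; rewrite mem_cat ys orbT.
Qed.

Lemma finite_dim_fg : finitely_generated mul -> finite_dim [set: A].
Proof.
case=> G [/finite_seqP[g ->] gen_g].
have [s [sU sp sw] sg] := invariant_span_gens g.
pose b := [:: e, w & s]; have subb := span_subspace b.
have be : span b e by apply: mem_span; rewrite mem_head.
have bw : span b w by apply: mem_span; rewrite !inE eqxx orbT.
have sb : span s `<=` span b.
  by apply: span_mono => x xs; rewrite !inE xs !orbT.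
suff -> : [set: A] = span b by exact: finite_dim_span.
rewrite -gen_g; apply/seteqP; split; last by rewrite gen_g.
(* It suffices that [span b] contains the generators, which follows from their Peirce components,
   and is a subalgebra. *)
apply: smallest_sub => [|x xg]; last first.
  have [v /V_line[c ->] ->] := peirce_decomp x.
  apply: (subspaceD subb _ (subspaceZ subb bw)).
  by apply: (subspaceD subb (subspaceZ subb be) _); apply/sb/sg.
have beU x : peirce_U x -> span b x -> span b (e ** x).
  move=> Ux bx; rewrite -[e ** x]scale1r -(mulVf two_neq0) -scalerA scaler_nat.
  by rewrite Ux; apply: subspaceZ.
have b0 : span b 0 by case: subb.
split=> // [|x y bx by_]; first exact: subb.2.
apply: (span_mul subb _ bx by_) => {x y bx by_} x y.
(* Multiplication table of e, w and [s]: e acts on U as 1/2 and kills w, both w^2 and the products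
   of w with [s] stay in [span s], and products within [s] lie in V = Kw. *)
rewrite !inE => /or3P[/eqP->|/eqP->|xs] /or3P[/eqP->|/eqP->|ys].
- by rewrite e_idem.
- by rewrite Vw.
- by apply: beU; [apply: sU|apply/sb/mem_span].
- by rewrite mulC Vw.
- exact: sb.
- by rewrite mulC; apply/sb/sw/mem_span.
- by rewrite mulC; apply: beU; [apply: sU|apply/sb/mem_span].
- exact/sb/sw/mem_span.
- by have [c ->] := V_line (peirce_UM (sU _ xs) (sU _ ys)); apply: subspaceZ.
Qed.

End Bernstein.

Theorem proposition7p2 (K : fieldType)
    (K_infinite : infinite_set [set: K])
    (K_char2 : 2%N \notin [pchar K]) (K_char3 : 3%N \notin [pchar K])
    (A : lmodType K) (mul : {bilinear A -> A -> A}) (omega : {scalar A})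
    (A_bernstein : is_bernstein mul omega)
    (e : A) (e_neq0 : e != 0) (e_idem : mul e e = e)
    (A_fg : finitely_generated mul)
    (dimV : has_dim (peirce_V mul e) 1)
    (A_algebraic : algebraic_algebra mul) :
  finite_dim [set: A].
Proof.
have [b [_ Vb]] := dimV.
(* The single basis vector of V plays the part of w. *)
have Vb0 : mul e (b ord0) = 0.
  suff : peirce_V mul e (b ord0) by [].
  by rewrite Vb; exists (fun=> 1); rewrite big_ord1 scale1r.
apply: (finite_dim_fg K_infinite K_char2 A_bernstein e_neq0 e_idem Vb0) => //.
move=> v Vv; have : peirce_V mul e v by [].
by rewrite Vb => -[c ->]; exists (c ord0); rewrite big_ord1.
Qed.
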